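(* Let $G=(V,E)$ be a locally finite, connected graph with symmetric edge weights and a uniformly positive measure, let $\alpha,\beta>1$, and let $\Omega_a,\Omega_b\subset V$ be such that $\Omega_a$, $\Omega_b$ and $\Omega_a\cap\Omega_b$ are non-empty bounded domains. Then the Dirichlet system $$-\Delta u+u=\tfrac{\alpha}{\alpha+\beta}|u|^{\alpha-2}u|v|^\beta\ \text{in }\Omega_a,\quad -\Delta v+v=\tfrac{\beta}{\alpha+\beta}|u|^{\alpha}|v|^{\beta-2}v\ \text{in }\Omega_b,\quad u=0\text{ on }\partial\Omega_a,\ v=0\text{ on }\partial\Omega_b$$ has a ground state solution $(u_\Omega,v_\Omega)\in H_\Omega$, i.e. a weak solution with $(u_\Omega,v_\Omega)\in\mathcal N_\Omega$ and $J_\Omega(u_\Omega,v_\Omega)=c_{\mathcal N_\Omega}$.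
   Context: $G=(V,E)$: $w_{xy}=w_{yx}>0$ for each edge $xy$ ($y\sim x$); $\mu:V\to(0,\infty)$, $\mu\ge\mu_{\min}>0$. $\Delta u(x)=\frac1{\mu(x)}\sum_{y\sim x}w_{xy}(u(y)-u(x))$, $\Gamma(u,v)(x)=\frac1{2\mu(x)}\sum_{y\sim x}w_{xy}(u(y)-u(x))(v(y)-v(x))$, $|\nabla u|^2=\Gamma(u,u)$, $\int_A f\,d\mu=\sum_{x\in A}\mu(x)f(x)$. A bounded domain is a set of vertices with uniformly bounded mutual graph distance. For $\Omega\subset V$: $\partial\Omega=\{y\notin\Omega:\exists x\in\Omega,\ xy\in E\}$, $\overline\Omega=\Omega\cup\partial\Omega$. $W_0^{1,2}(\Omega)$ is the completion of $C_c(\Omega)=\{u:V\to\mathbb{R}$ with support in $\Omega$ (so $u=0$ on $\partial\Omega$)$\}$ under $\|u\|=(\int_{\overline\Omega}|\nabla u|^2d\mu+\int_\Omega u^2d\mu)^{1/2}$. $H_\Omega=W_0^{1,2}(\Omega_a)\times W_0^{1,2}(\Omega_b)$ with inner product $\langle(u,v),(\xi,\eta)\rangle_{H_\Omega}=\int_{\overline\Omega_a\cup\overline\Omega_b}(\Gamma(u,\xi)+\Gamma(v,\eta))d\mu+\int_{\Omega_a\cup\Omega_b}(u\xi+v\eta)d\mu$. $J_\Omega(u,v)=\frac12\int_{\overline\Omega_a\cup\overline\Omega_b}(|\nabla u|^2+|\nabla v|^2)d\mu+\frac12\int_{\Omega_a\cup\Omega_b}(u^2+v^2)d\mu-\frac1{\alpha+\beta}\int_{\Omega_a\cup\Omega_b}|u|^\alpha|v|^\beta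 d\mu$. A weak solution is $(u,v)\in H_\Omega$ with $\langle(u,v),(\xi,\eta)\rangle_{H_\Omega}=\int_{\Omega_a\cup\Omega_b}(\frac{\alpha}{\alpha+\beta}|u|^{\alpha-2}u|v|^\beta\xi+\frac{\beta}{\alpha+\beta}|u|^\alpha|v|^{\beta-2}v\eta)d\mu$ for all $(\xi,\eta)\in H_\Omega$. $\mathcal N_\Omega=\{(u,v)\in H_\Omega\setminus\{(0,0)\}:\langle J_\Omega'(u,v),(u,v)\rangle=0\}$, $c_{\mathcal N_\Omega}=\inf_{\mathcal N_\Omega}J_\Omega$. *)

(* Defs.v *)
From HB Require Import structures.
From mathcomp Require Import all_boot all_order all_algebra.
From mathcomp Require Import all_classical all_reals all_analysis.
Set Implicit Arguments. Unset Strict Implicit. Unset Printing Implicit Defensive.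
Import Order.TTheory GRing.Theory Num.Theory.
Import numFieldNormedType.Exports.
Local Open Scope classical_set_scope.
Local Open Scope ring_scope.

Section Graph.
Variables (R : realType) (V : choiceType).
(* Weighted graph: w x y > 0 iff xy is an edge (with weight w x y);
   w x y = 0 for non-edges. *)
Variables (w : V -> V -> R) (mu : V -> R).

Definition nbr (x : V) : set V := [set y | 0 < w x y].

Inductive reach : nat -> V -> V -> Prop :=
| reach0 x : reach 0 x x
| reachS n x y z : 0 < w x y -> reach n y z -> reach n.+1 x z.

Definition graph_connected : Prop := forall x y, exists n, reach n x y.

Definition dist_le (D : nat) (x y : V) : Prop := exists2 n, (n <= D)%N & reach n x y.

Definition bounded_domain (O : set V) : Prop :=
  exists D : nat, forall x y, O x -> O y -> dist_le D x y.

Definition locally_finite : Prop := forall x, finite_set (nbr x).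

Definition Lap (u : V -> R) (x : V) : R :=
  (mu x)^-1 * \sum_(y \in nbr x) w x y * (u y - u x).

Definition Gam (u v : V -> R) (x : V) : R :=
  (2 * mu x)^-1 * \sum_(y \in nbr x) w x y * (u y - u x) * (v y - v x).

Definition integ (A : set V) (f : V -> R) : R := \sum_(x \in A) mu x * f x.

Definition bdry (O : set V) : set V :=
  [set y | ~ O y /\ exists2 x, O x & 0 < w x y].

Definition clos (O : set V) : set V := O `|` bdry O.

Definition Cc (O : set V) (u : V -> R) : Prop := forall x, ~ O x -> u x = 0.

Definition sob_norm (O : set V) (u : V -> R) : R :=
  Num.sqrt (integ (clos O) (Gam u u) + integ O (fun x => u x ^+ 2)).

(* W_0^{1,2}(O): completion of C_c(O) under sob_norm, realized as the
   functions vanishing outside O that are sob_norm-limits of elements of C_c(O). *)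
Definition W0 (O : set V) (u : V -> R) : Prop :=
  Cc O u /\ exists phi : nat -> V -> R,
    (forall n, Cc O (phi n)) /\
    (fun n => sob_norm O (fun x => phi n x - u x)) @ \oo --> (0 : R).

Definition H (Oa Ob : set V) (u v : V -> R) : Prop := W0 Oa u /\ W0 Ob v.

Definition ipH (Oa Ob : set V) (u v xi eta : V -> R) : R :=
  integ (clos Oa `|` clos Ob) (fun x => Gam u xi x + Gam v eta x)
  + integ (Oa `|` Ob) (fun x => u x * xi x + v x * eta x).

Definition J (a b : R) (Oa Ob : set V) (u v : V -> R) : R :=
  2^-1 * integ (clos Oa `|` clos Ob) (fun x => Gam u u x + Gam v v x)
  + 2^-1 * integ (Oa `|` Ob) (fun x => u x ^+ 2 + v x ^+ 2)
  - (a + b)^-1 * integ (Oa `|` Ob) (fun x => (`|u x| `^ a) * (`|v x| `^ b)).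

Definition weak_solution (a b : R) (Oa Ob : set V) (u v : V -> R) : Prop :=
  H Oa Ob u v /\
  forall xi eta, H Oa Ob xi eta ->
    ipH Oa Ob u v xi eta =
    integ (Oa `|` Ob) (fun x =>
      a / (a + b) * (`|u x| `^ (a - 2)) * u x * (`|v x| `^ b) * xi x
      + b / (a + b) * (`|u x| `^ a) * (`|v x| `^ (b - 2)) * v x * eta x).

Definition dJ (a b : R) (Oa Ob : set V) (u v xi eta : V -> R) : R :=
  derive1 (fun t : R => J a b Oa Ob (fun x => u x + t * xi x) (fun x => v x + t * eta x)) 0.

Definition Nehari (a b : R) (Oa Ob : set V) : set ((V -> R) * (V -> R)) :=
  [set p | H Oa Ob p.1 p.2 /\ (p.1 <> (fun _ => 0) \/ p.2 <> (fun _ => 0))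
           /\ dJ a b Oa Ob p.1 p.2 p.1 p.2 = 0].

Definition cN (a b : R) (Oa Ob : set V) : R :=
  inf [set J a b Oa Ob p.1 p.2 | p in Nehari a b Oa Ob].

End Graph.

(* Main.v *)
Require Import Defs.
From HB Require Import structures.
From mathcomp Require Import all_boot all_order all_algebra.
From mathcomp Require Import all_classical all_reals all_analysis.
From mathcomp Require Import finmap ring lra.
Import Order.TTheory GRing.Theory Num.Theory.
Import numFieldNormedType.Exports.
Local Open Scope classical_set_scope.
Local Open Scope ring_scope.
Set Implicit Arguments. Unset Strict Implicit. Unset Printing Implicit Defensive.

(** Bounded sets of a locally finite graph are finite, so the problem is
finite-dimensional.  Write Q(u,v) for the squared norm of H and P(u,v) for the
integral of |u|^a |v|^b.  By compactness P attains a maximum M > 0 on {Q = 1},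
hence P <= M Q^((a+b)/2) by homogeneity.  Rescale the maximiser by the t with
M t^(a+b-2) = 1: then Q = P = t^2, which puts it on the Nehari set.  There
J = (1/2 - 1/(a+b)) Q, and Q = P <= M Q^((a+b)/2) forces Q >= t^2, so the
rescaled pair minimises J.  Since M Q^((a+b)/2) - P is nonnegative and vanishes
at this pair, its derivative there vanishes, which is the weak equation. *)

(** * Calculus of real powers of the absolute value *)

Section PowerNorm.
Variable R : realType.
Implicit Types a b x y : R.

(** Away from 0 this is the chain rule on each side. At 0 the factor [x] kills the formula whatever
    value the power has there, and the difference quotient has size |h|^(a-1), which tends to 0
    since a > 1. *)
Lemma is_derive_powR_norm a x : 1 < a ->
  is_derive x 1 (fun y : R => `|y| `^ a) (a * `|x| `^ (a - 2) * x).
Proof.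
move=> a1; case: (ltgtP x 0) => [x0|x0|->].
- have Nx0 : 0 < - x by rewrite oppr_gt0.
  have E : \forall y \near x, ((fun z : R => z `^ a) \o -%R) y = `|y| `^ a.
    near=> y => /=; rewrite ltr0_norm //; near: y; exact: lt_nbhsl.
  have D := is_derive1_comp (is_derive1_powR a Nx0) (is_deriveNid x 1).
  apply: (is_derive_eq (near_eq_is_derive E D)).
  rewrite ltr0_norm // (_ : a - 1 = a - 2 + 1); last by ring.
  rewrite powRD; last by rewrite (gt_eqF Nx0) implybT.
  by rewrite powRr1 ?ltW //; ring.
- have E : \forall y \near x, y `^ a = `|y| `^ a.
    near=> y => /=; rewrite gtr0_norm //; near: y; exact: lt_nbhsr.
  apply: (is_derive_eq (near_eq_is_derive E (is_derive1_powR a x0))).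
  rewrite gtr0_norm // (_ : a - 1 = a - 2 + 1); last by ring.
  rewrite powRD; last by rewrite (gt_eqF x0) implybT.
  by rewrite powRr1 ?ltW //; ring.
- rewrite mulr0.
  have a10 : 0 < a - 1 by rewrite subr_gt0.
  have L : h^-1 *: (((fun y : R => `|y| `^ a) \o shift 0) (h *: 1) - `|0 : R| `^ a)
     @[h --> (0 : R)^'] --> (0 : R).
    apply/cvgrPdist_lt => e e0.
    (* This radius solves |h|^(a-1) = e. *)
    have d0 : 0 < e `^ (a - 1)^-1 by rewrite powR_gt0.
    near=> h.
    have h0 : h != 0 by near: h; exact: nbhs_dnbhs_neq.
    have hd : `|h| < e `^ (a - 1)^-1.
      near: h; apply: dnbhs0_lt => //.
    rewrite /= addr0 normr0 powR0 ?gt_eqF ?(lt_trans _ a1) // subr0 sub0r normrN.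
    rewrite /GRing.scale /= mulr1 normrM normfV (ger0_norm (powR_ge0 _ _)).
    rewrite (_ : a = 1 + (a - 1)); last by ring.
    rewrite powRD; last by rewrite normr_eq0 h0 implybT.
    rewrite powRr1 // mulKf ?normr_eq0 //.
    have := gt0_ltr_powR a10 (normr_ge0 h) (ltW d0) hd.
    by rewrite -powRrM mulVf ?gt_eqF // powRr1 ?ltW.
  split; first by apply/cvg_ex; exists 0; exact: L.
  exact: (cvg_lim _ L).
Unshelve. all: end_near. Qed.

Lemma continuous_powR_norm a : 1 < a -> continuous (fun y : R => `|y| `^ a).
Proof.
move=> a1 x; apply/differentiable_continuous/derivable1_diffP.
by case: (is_derive_powR_norm x a1).
Qed.

Lemma powR_norm_mul a x : 1 < a -> `|x| `^ (a - 2) * x * x = `|x| `^ a.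
Proof.
move=> a1; rewrite -mulrA -expr2 -(real_normK (num_real x)).
have [->|x0] := eqVneq x 0.
  by rewrite normr0 expr0n mulr0 powR0 // gt_eqF // (lt_trans _ a1).
by rewrite -powR_mulrn // -powRD ?subrK // normr_eq0 x0 implybT.
Qed.

Lemma is_derive_powR_norm_affine a b u v xi eta (s : R) : 1 < a -> 1 < b ->
  is_derive s 1 (fun t : R => `|u + t * xi| `^ a * `|v + t * eta| `^ b)
    (a * `|u + s * xi| `^ (a - 2) * (u + s * xi) * `|v + s * eta| `^ b * xi
     + b * `|u + s * xi| `^ a * `|v + s * eta| `^ (b - 2) * (v + s * eta) * eta).
Proof.
move=> a1 b1.
have aff (c d : R) : is_derive s 1 (fun t : R => c + t * d) d.
  have H1 := is_deriveD (is_derive_cst c s 1)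
    (is_deriveM (is_derive_id s 1) (is_derive_cst d s 1)).
  apply: (is_derive_eq H1).
  by rewrite add0r scaler0 add0r /GRing.scale /= mulr1.
have H1 := @is_derive1_comp R (fun y => `|y| `^ a) (fun t => u + t * xi) s _ _
  (is_derive_powR_norm (u + s * xi) a1) (aff u xi).
have H2 := @is_derive1_comp R (fun y => `|y| `^ b) (fun t => v + t * eta) s _ _
  (is_derive_powR_norm (v + s * eta) b1) (aff v eta).
apply: (is_derive_eq (is_deriveM H1 H2)).
by rewrite /GRing.scale /=; ring.
Qed.

Lemma is_derive_quadratic (c d e s : R) :
  is_derive s 1 (fun t : R => c + 2 * t * d + t ^+ 2 * e) (2 * d + 2 * s * e).
Proof.
have H1 := is_deriveD (is_deriveD (is_derive_cst c s 1)
  (is_deriveM (is_deriveM (is_derive_cst (2 : R) s 1) (is_derive_id s 1)) (is_derive_cst d s 1)))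
  (is_deriveM (is_deriveX 2 (is_derive_id s 1)) (is_derive_cst e s 1)).
by apply: (is_derive_eq H1); rewrite /GRing.scale /=; ring.
Qed.

Lemma is_derive_big_seq (I : Type) (r : seq I) (h : I -> R -> R) (dh : I -> R) x :
  (forall i, is_derive x 1 (h i) (dh i)) ->
  is_derive x 1 (fun y => \sum_(i <- r) h i y) (\sum_(i <- r) dh i).
Proof.
move=> hd; elim: r => [|i r IH].
  rewrite big_nil (_ : (fun _ => _) = cst 0); first exact: is_derive_cst.
  by apply/funext => y; rewrite big_nil.
rewrite big_cons (_ : (fun _ => _) = h i + (fun y => \sum_(j <- r) h j y)).
  exact: is_deriveD.
by apply/funext => y; rewrite big_cons.
Qed.

Lemma continuous_big_seq (T : topologicalType) (I : Type) (r : seq I) (f : I -> T -> R) :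
  (forall i, continuous (f i)) -> continuous (fun t => \sum_(i <- r) f i t).
Proof.
move=> fc; elim: r => [|i r IH].
  rewrite (_ : (fun _ => _) = cst 0); first by move=> t; exact: cvg_cst.
  by apply/funext => t; rewrite big_nil.
rewrite (_ : (fun _ => _) = fun t => f i t + \sum_(j <- r) f j t).
  by move=> t; apply: cvgD; [exact: fc|exact: IH].
by apply/funext => t; rewrite big_cons.
Qed.

End PowerNorm.

(** * Finiteness of bounded domains and algebra of the energy *)

Section GraphFunctionals.
Variables (R : realType) (V : choiceType) (w : V -> V -> R) (mu : V -> R).
Implicit Types (u v xi eta f g : V -> R) (s t c : R).
Hypothesis hlf : locally_finite w.

(** A walk of length n + 1 first moves to one of finitely many neighbours, so induction gives a
    finite union of finite sets. *)
Lemma finite_reach n x : finite_set [set z | reach w n x z].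
Proof.
elim: n x => [|n IH] x.
  apply: (sub_finite_set _ (finite_set1 x)) => z /= h.
  by inversion h.
apply: (sub_finite_set _ (bigcup_finite (hlf x) (fun y _ => IH y))) => z /= h.
by inversion h; subst; exists y.
Qed.

Lemma bounded_domain_finite (O : set V) : bounded_domain w O -> finite_set O.
Proof.
move=> [D hD]; have [->|/set0P[x Ox]] := eqVneq O set0; first exact: finite_set0.
(* All of [O] is reached from the one vertex [x]; [D.+1] because lengths run from 0 to [D]
   inclusive. *)
apply: (sub_finite_set _ (bigcup_finite (finite_II D.+1)
  (fun n _ => finite_reach n x))) => y Oy.
by have [n nD rn] := hD _ _ Ox Oy; exists n.
Qed.

Lemma finite_clos (O : set V) : finite_set O -> finite_set (clos w O).
Proof.
move=> fO; rewrite finite_setU; split => //.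
apply: (sub_finite_set _ (bigcup_finite fO (fun x _ => hlf x))) => y [_ [x Ox xy]].
by exists x.
Qed.

Lemma integE (A : set V) f : finite_set A ->
  integ mu A f = \sum_(x <- fset_set A) mu x * f x.
Proof. by move=> fA; rewrite /integ fsbig_finite. Qed.

Lemma GamE u v x : Gam w mu u v x =
  (2 * mu x)^-1 * \sum_(y <- fset_set (nbr w x)) w x y * (u y - u x) * (v y - v x).
Proof. by rewrite /Gam fsbig_finite. Qed.

Lemma integD (A : set V) f g : finite_set A ->
  integ mu A (fun x => f x + g x) = integ mu A f + integ mu A g.
Proof.
by move=> fA; rewrite !integE // -big_split; apply: eq_bigr => x _; rewrite mulrDr.
Qed.

Lemma integZ (A : set V) c f : finite_set A ->
  integ mu A (fun x => c * f x) = c * integ mu A f.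
Proof.
by move=> fA; rewrite !integE // mulr_sumr; apply: eq_bigr => x _; rewrite mulrCA.
Qed.

(** The constant sequence approximates [u]. As [W0] includes the support condition, the two spaces
    coincide, and membership only means vanishing outside the domain. *)
Lemma Cc_W0 (O : set V) u : Cc O u -> W0 w mu O u.
Proof.
move=> Ou; split => //; exists (fun=> u); split => // {Ou}.
rewrite (_ : (fun _ => _) = cst 0); first exact: cvg_cst.
apply/funext => n; rewrite /sob_norm /=.
rewrite (_ : (fun x => u x - u x) = fun=> 0); last by apply/funext => x; rewrite subrr.
have G0 x : Gam w mu (fun=> 0) (fun=> 0) x = 0.
  by rewrite GamE big1 ?mulr0 // => y _; rewrite subrr !mulr0.
rewrite /integ fsbig1 => [|x _]; last by rewrite G0 mulr0.
rewrite fsbig1 => [|x _]; last by rewrite subrr expr0n mulr0.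
by rewrite addr0 sqrtr0.
Qed.

Lemma Gam_affine u xi s x :
  Gam w mu (fun z => u z + s * xi z) (fun z => u z + s * xi z) x =
  Gam w mu u u x + 2 * s * Gam w mu u xi x + s ^+ 2 * Gam w mu xi xi x.
Proof.
rewrite !GamE; move: (2 * mu x)^-1 => c.
rewrite !mulr_sumr -!big_split; apply: eq_bigr => y _ /=; ring.
Qed.

(** * Positivity of the energy *)

Hypothesis w_ge0 : forall x y, 0 <= w x y.
Hypothesis mu_gt0 : forall x, 0 < mu x.

Lemma Gam_ge0 u x : 0 <= Gam w mu u u x.
Proof.
rewrite GamE mulr_ge0 ?invr_ge0 ?mulr_ge0 ?(ltW (mu_gt0 _)) //.
by apply: sumr_ge0 => y _; rewrite -mulrA mulr_ge0 // -expr2 sqr_ge0.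
Qed.

Lemma le_integ (A : set V) f x : finite_set A -> (forall y, 0 <= f y) -> A x ->
  mu x * f x <= integ mu A f.
Proof.
move=> fA f0 Ax; rewrite integE // (bigD1_seq x) ?finmap.fset_uniq //=; last first.
  by rewrite in_fset_set // mem_set.
by rewrite lerDl sumr_ge0 // => y _; rewrite mulr_ge0 // ltW.
Qed.

Lemma integ_ge0 (A : set V) f : finite_set A -> (forall y, 0 <= f y) -> 0 <= integ mu A f.
Proof.
by move=> fA f0; rewrite integE // sumr_ge0 // => y _; rewrite mulr_ge0 // ltW.
Qed.

Variables (a b : R).
Hypotheses (a1 : 1 < a) (b1 : 1 < b).
Variables (Oa Ob : set V).
Hypotheses (fOa : finite_set Oa) (fOb : finite_set Ob).

Let fO : finite_set (Oa `|` Ob).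
Proof. by rewrite finite_setU. Qed.

Let fC : finite_set (clos w Oa `|` clos w Ob).
Proof. by rewrite finite_setU; split; exact: finite_clos. Qed.

Definition coupling u v : R :=
  integ mu (Oa `|` Ob) (fun x => `|u x : R| `^ a * `|v x : R| `^ b).

(** Derivative of [coupling] at (u,v) in the direction (xi,eta), which is a + b times the right-hand
    side of the weak equation. *)
Definition dcoupling u v xi eta : R := integ mu (Oa `|` Ob) (fun x =>
  a * `|u x : R| `^ (a - 2) * u x * `|v x : R| `^ b * xi x
  + b * `|u x| `^ a * `|v x| `^ (b - 2) * v x * eta x).

Local Notation Q u v := (ipH w mu Oa Ob u v u v).
Local Notation P := coupling.
Local Notation dP := dcoupling.

Lemma JE u v : J w mu a b Oa Ob u v = 2^-1 * Q u v - (a + b)^-1 * P u v.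
Proof. by rewrite /J /ipH mulrDr. Qed.

(** Bilinearity and symmetry make the squared norm quadratic along a line; its scaling and its
    derivative are both read off from this. *)
Lemma ipH_affine u v xi eta s :
  Q (fun x => u x + s * xi x) (fun x => v x + s * eta x) =
  Q u v + 2 * s * ipH w mu Oa Ob u v xi eta + s ^+ 2 * Q xi eta.
Proof.
rewrite /ipH (_ : (fun x => Gam _ _ _ _ x + Gam _ _ _ _ x) =
  fun x => (Gam w mu u u x + Gam w mu v v x) +
    (2 * s * (Gam w mu u xi x + Gam w mu v eta x)
    + s ^+ 2 * (Gam w mu xi xi x + Gam w mu eta eta x))); last first.
  by apply/funext => x; rewrite !Gam_affine; ring.
rewrite (_ : (fun x => (u x + s * xi x) * _ + _) =
  fun x => (u x * u x + v x * v x) +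
    (2 * s * (u x * xi x + v x * eta x)
    + s ^+ 2 * (xi x * xi x + eta x * eta x))); last first.
  by apply/funext => x; ring.
rewrite integD // (integD (fun x => 2 * s * _)) // !integZ //.
rewrite (integD (fun x => u x * u x + v x * v x)) //.
rewrite (integD (fun x => 2 * s * (u x * xi x + v x * eta x))) // !integZ //.
ring.
Qed.

Lemma ipH_scale u v t :
  Q (fun x => t * u x) (fun x => t * v x) = t ^+ 2 * Q u v.
Proof.
(* Scaling by [t] is a move by [t - 1] in the direction of the pair itself. *)
rewrite (_ : (fun x => t * u x) = fun x => u x + (t - 1) * u x); last first.
  by apply/funext => x; ring.
rewrite (_ : (fun x => t * v x) = fun x => v x + (t - 1) * v x); last first.
  by apply/funext => x; ring.
by rewrite ipH_affine; ring.
Qed.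

(** The gradient part and the other vertices contribute nonnegatively. This pointwise control bounds
    the unit sphere and makes the squared norm definite. *)
Lemma ipH_ge_sqr u v x : (Oa `|` Ob) x -> mu x * (u x ^+ 2 + v x ^+ 2) <= Q u v.
Proof.
move=> Ox; rewrite -[leLHS]add0r; apply: lerD.
  by apply: integ_ge0 => // y; rewrite addr_ge0 ?Gam_ge0.
by apply: (le_integ (f := fun y => u y ^+ 2 + v y ^+ 2)) => // y;
  rewrite addr_ge0 ?sqr_ge0.
Qed.

Lemma ipH_ge0 u v : 0 <= Q u v.
Proof.
apply: addr_ge0; apply: integ_ge0 => // y; first by rewrite addr_ge0 ?Gam_ge0.
by rewrite -!expr2 addr_ge0 ?sqr_ge0.
Qed.

Lemma ipH_gt0 u v : Cc Oa u -> Cc Ob v ->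
  (u <> (fun=> 0) \/ v <> (fun=> 0)) -> 0 < Q u v.
Proof.
move=> Cu Cv uv0.
(* Since [u] and [v] vanish off their domains, a nonzero value must occur on the union. *)
have [x [Ox xn0]] : exists x, (Oa `|` Ob) x /\ 0 < u x ^+ 2 + v x ^+ 2.
  apply: contrapT => nx; have Z x : u x = 0 /\ v x = 0.
    have [Ox|nOx] := pselect ((Oa `|` Ob) x); last first.
      by split; [apply: Cu => ?; apply: nOx; left|apply: Cv => ?; apply: nOx; right].
    have : u x ^+ 2 + v x ^+ 2 == 0.
      rewrite eq_le addr_ge0 ?sqr_ge0 // andbT leNgt; apply/negP => h.
      by apply: nx; exists x.
    by rewrite paddr_eq0 ?sqr_ge0 // !sqrf_eq0 => /andP[/eqP -> /eqP ->].
  by case: uv0; apply; apply/funext => x; case: (Z x).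
by apply: lt_le_trans (ipH_ge_sqr u v Ox); rewrite mulr_gt0.
Qed.

Lemma coupling_ge0 u v : 0 <= P u v.
Proof. by apply: integ_ge0 => // x; rewrite mulr_ge0 ?powR_ge0. Qed.

Lemma coupling_scale u v t : 0 < t ->
  P (fun x => t * u x) (fun x => t * v x) = t `^ (a + b) * P u v.
Proof.
move=> t0; rewrite /coupling -integZ //; congr integ; apply/funext => x.
rewrite !normrM (gtr0_norm t0) !powRM ?(ltW t0) //.
by rewrite powRD ?(gt_eqF t0) ?implybT //; ring.
Qed.

Lemma coupling_eq0 u v : (forall x, (Oa `|` Ob) x -> u x = 0) -> P u v = 0.
Proof.
move=> u0; rewrite /coupling /integ fsbig1 // => x Ox.
by rewrite u0 // normr0 powR0 ?mul0r ?mulr0 // gt_eqF // (lt_trans _ a1).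
Qed.

(** * Directional derivatives *)

Lemma is_derive_coupling u v xi eta s :
  is_derive s 1 (fun t => P (fun x => u x + t * xi x) (fun x => v x + t * eta x))
    (dP (fun x => u x + s * xi x) (fun x => v x + s * eta x) xi eta).
Proof.
rewrite /dcoupling integE // (_ : (fun t => _) = fun t => \sum_(x <- fset_set (Oa `|` Ob))
   mu x * (`|u x + t * xi x| `^ a * `|v x + t * eta x| `^ b)); last first.
  by apply/funext => t; rewrite /coupling integE.
apply: is_derive_big_seq => x.
exact: is_deriveZ (is_derive_powR_norm_affine (u x) (v x) (xi x) (eta x) s a1 b1).
Qed.

Lemma is_derive_ipH u v xi eta s :
  is_derive s 1 (fun t => Q (fun x => u x + t * xi x) (fun x => v x + t * eta x))
    (2 * ipH w mu Oa Ob u v xi eta + 2 * s * Q xi eta).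
Proof.
rewrite (_ : (fun t => _) = fun t => Q u v + 2 * t * ipH w mu Oa Ob u v xi eta
  + t ^+ 2 * Q xi eta); last by apply/funext => t; rewrite ipH_affine.
exact: is_derive_quadratic.
Qed.

(** Euler's identity: [coupling] is homogeneous of degree a + b. *)
Lemma dcoupling_self u v : dP u v u v = (a + b) * P u v.
Proof.
rewrite /dcoupling /coupling -integZ //; congr integ; apply/funext => x.
have -> : a * `|u x| `^ (a - 2) * u x * `|v x| `^ b * u x
   = a * (`|u x| `^ (a - 2) * u x * u x) * `|v x| `^ b by ring.
have -> : b * `|u x| `^ a * `|v x| `^ (b - 2) * v x * v x
   = b * `|u x| `^ a * (`|v x| `^ (b - 2) * v x * v x) by ring.
by rewrite !powR_norm_mul //; ring.
Qed.

(** Along the pair itself Q/2 has derivative Q and, by Euler's identity, P/(a+b) has derivative P.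
    Nehari pairs are thus the nonzero ones with Q = P. *)
Lemma dJ_self u v : dJ w mu a b Oa Ob u v u v = Q u v - P u v.
Proof.
rewrite /dJ derive1E.
rewrite (_ : (fun t => _) = (fun t => 2^-1 * Q (fun x => u x + t * u x) (fun x => v x + t * v x))
   - (fun t => (a + b)^-1 * P (fun x => u x + t * u x) (fun x => v x + t * v x))); last first.
  by apply/funext => t; rewrite JE.
have H := is_deriveB (is_deriveZ 2^-1 (is_derive_ipH u v u v 0))
   (is_deriveZ (a + b)^-1 (is_derive_coupling u v u v 0)).
rewrite (@derive_val _ _ _ _ _ _ _ H).
have add0 (f g : V -> R) : (fun x => f x + 0 * g x) = f.
  by apply/funext => x; rewrite mul0r addr0.
have p0 : a + b != 0 by rewrite gt_eqF // addr_gt0 // (lt_trans _ a1, lt_trans _ b1).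
rewrite !add0 dcoupling_self /GRing.scale /= mulKf //.
by field.
Qed.

(** * Continuity and the maximum of the coupling on the unit sphere *)

Lemma continuous_ipH (T : topologicalType) (f g : T -> V -> R) :
  (forall x, continuous (f ^~ x)) -> (forall x, continuous (g ^~ x)) ->
  continuous (fun z => Q (f z) (g z)).
Proof.
move=> fc gc.
have Gc (h : T -> V -> R) x : (forall x, continuous (h ^~ x)) ->
    continuous (fun z => (2 * mu x)^-1 * \sum_(y <- fset_set (nbr w x))
      w x y * (h z y - h z x) * (h z y - h z x)).
  move=> hc z; apply: cvgM; first exact: cvg_cst.
  apply: continuous_big_seq => y p.
  by apply: cvgM; [apply: cvgM; [exact: cvg_cst|]|]; apply: cvgB; exact: hc.
under [X in continuous X]funext do
  (rewrite /ipH !integE //; under eq_bigr do rewrite !GamE).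
move=> z; apply: cvgD; apply: continuous_big_seq => x {}z.
  by apply: cvgM; [exact: cvg_cst|apply: cvgD; exact: Gc].
apply: cvgM; [exact: cvg_cst|apply: cvgD; apply: cvgM];
  by [exact: fc|exact: gc].
Qed.

Lemma continuous_coupling (T : topologicalType) (f g : T -> V -> R) :
  (forall x, continuous (f ^~ x)) -> (forall x, continuous (g ^~ x)) ->
  continuous (fun z => P (f z) (g z)).
Proof.
move=> fc gc.
have pc (h : T -> R) c : 1 < c -> continuous h -> continuous (fun z => `|h z| `^ c).
  move=> c1 hc z; apply: (@continuous_comp _ _ _ h (fun y : R => `|y| `^ c)).
    exact: hc.
  exact: continuous_powR_norm.
under [X in continuous X]funext do rewrite /coupling integE //.
apply: continuous_big_seq => x z; apply: cvgM; first exact: cvg_cst.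
by apply: cvgM; exact: pc.
Qed.

Hypothesis Oab0 : Oa `&` Ob !=set0.

(** Take both components equal to the indicator of a vertex common to the two domains, divided by
    the norm of the pair; at that vertex the coupling is positive. *)
Lemma unit_sphere_neq0 : exists u v,
  [/\ Cc Oa u, Cc Ob v, Q u v = 1 & 0 < P u v].
Proof.
have [x [ax bx]] := Oab0.
pose d (y : V) : R := (y == x)%:R.
have dx : d x = 1 by rewrite /d eqxx.
have Cd O : O x -> Cc O d.
  move=> Ox y nOy; rewrite /d; case: eqP => // yx; case: nOy; by rewrite yx.
have Q0 : 0 < Q d d.
  apply: ipH_gt0; [exact: Cd|exact: Cd|left].
  by move/(congr1 (fun f => f x)); rewrite dx => /eqP; rewrite oner_eq0.
have P0 : 0 < P d d.
  apply: (@lt_le_trans _ _ (mu x * (`|d x| `^ a * `|d x| `^ b))).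
    by rewrite dx normr1 !powR1 !mulr1.
  apply: (le_integ (f := fun y => `|d y| `^ a * `|d y| `^ b)) => //; by left.
pose r := (Num.sqrt (Q d d))^-1.
have r0 : 0 < r by rewrite invr_gt0 sqrtr_gt0.
have Cr O : O x -> Cc O (fun y => r * d y).
  by move=> Ox y nOy; rewrite (Cd O) ?mulr0.
exists (fun y => r * d y), (fun y => r * d y); split; [exact: Cr|exact: Cr| |].
  by rewrite ipH_scale exprVn sqr_sqrtr ?mulVf ?gt_eqF // ltW.
by rewrite coupling_scale // mulr_gt0 // powR_gt0.
Qed.

Import ArrowAsProduct.

Lemma coupling_max : exists u v, [/\ Cc Oa u, Cc Ob v, Q u v = 1, 0 < P u v &
  forall u' v', Cc Oa u' -> Cc Ob v' -> Q u' v' = 1 -> P u' v' <= P u v].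
Proof.
(* A pair (u, v) is one function on V + V, so that Tychonoff's theorem gives compactness. *)
pose D (i : V + V) := match i with inl x => Oa x | inr x => Ob x end.
pose m (i : V + V) := match i with inl x => mu x | inr x => mu x end.
(* Radius 0 off the domain encodes the Dirichlet condition; on the domain 1 + 1/mu bounds every
   value compatible with Q = 1. *)
pose r i := if `[< D i >] then 1 + (m i)^-1 else 0.
pose B := [set f : (V + V)%type -> R | forall i, `[- r i, r i]%classic (f i)].
pose QQ (f : (V + V)%type -> R) := Q (fun x => f (inl x)) (fun x => f (inr x)).
have ev i : continuous (fun f : (V + V)%type -> R => f i).
  exact: (@proj_continuous (V + V)%type (fun _ => R) i).
have QQc : continuous QQ.
  by apply: continuous_ipH => x; exact: ev.
have PPc : continuous (fun f : (V + V)%type -> R =>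
    P (fun x => f (inl x)) (fun x => f (inr x))).
  by apply: continuous_coupling => x; exact: ev.
have cB : compact B.
  by apply: (@tychonoff (V + V)%type (fun _ => R) (fun i => `[- r i, r i]%classic))
    => i; exact: segment_compact.
have cS : compact (B `&` QQ @^-1` [set x | x = 1]).
  apply: compact_closedI => //; apply: preimage_closed; last exact: closed_eq.
  by move=> f _; exact: QQc.
(* From 2|z| <= z^2 + 1 <= 1 + 1/c, which avoids a square root. *)
have sq (c z : R) : 0 < c -> c * z ^+ 2 <= 1 -> - (1 + c^-1) <= z <= 1 + c^-1.
  move=> c0; rewrite mulrC -ler_pdivlMr // div1r => z2.
  by rewrite -ler_norml; have := sqr_ge0 (`|z| - 1); have := normr_ge0 z;
     rewrite -(real_normK (num_real z)) in z2; nra.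
have inS u v : Cc Oa u -> Cc Ob v -> Q u v = 1 ->
    (B `&` QQ @^-1` [set x | x = 1])
      (fun i => match i with inl x => u x | inr x => v x end).
  move=> Cu Cv Q1; split => // i.
  rewrite /r; case: asboolP => /= Di; last first.
    by case: i Di => x Di; rewrite in_itv /= ?(Cu _ Di) ?(Cv _ Di) oppr0 lexx.
  rewrite in_itv /=; case: i Di => x /= Dx; apply: sq => //.
    apply: le_trans (_ : _ <= Q u v) _; last by rewrite Q1.
    apply: le_trans (ipH_ge_sqr u v (or_introl Dx)).
    by rewrite ler_pM2l // lerDl sqr_ge0.
  apply: le_trans (_ : _ <= Q u v) _; last by rewrite Q1.
  apply: le_trans (ipH_ge_sqr u v (or_intror Dx)).
  by rewrite ler_pM2l // lerDr sqr_ge0.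
have [u0 [v0 [Cu0 Cv0 Q0 P0]]] := unit_sphere_neq0.
(* The box is compact and {Q = 1} is closed and meets it, so P attains its maximum there. *)
have [f /set_mem [Bf Qf] fmax] := compact_EVT_max
  (ex_intro _ _ (inS _ _ Cu0 Cv0 Q0)) cS
  (continuous_subspaceT PPc).
have fmax' u v : Cc Oa u -> Cc Ob v -> Q u v = 1 ->
    P u v <= P (fun x => f (inl x)) (fun x => f (inr x)).
  by move=> Cu Cv Q1; exact: fmax _ (mem_set (inS _ _ Cu Cv Q1)).
have Bf0 i : ~ D i -> f i = 0.
  move=> nD; have := Bf i; rewrite /r; case: asboolP => //= _.
  by rewrite in_itv /= oppr0 -eq_le => /eqP.
exists (fun x => f (inl x)), (fun x => f (inr x)); split => //.
- by move=> x nx; exact: (Bf0 (inl x)).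
- by move=> x nx; exact: (Bf0 (inr x)).
- exact: lt_le_trans P0 (fmax' _ _ Cu0 Cv0 Q0).
Qed.

(** Homogeneity carries the bound off the unit sphere: divide the pair by the square root of Q. The
    absolute value, harmless since Q >= 0, lets [is_derive_powR_norm] differentiate the right-hand
    side. *)
Lemma coupling_le u0 v0 : Q u0 v0 = 1 ->
  (forall u v, Cc Oa u -> Cc Ob v -> Q u v = 1 -> P u v <= P u0 v0) ->
  forall u v, Cc Oa u -> Cc Ob v -> P u v <= P u0 v0 * `|Q u v| `^ ((a + b) / 2).
Proof.
move=> Q0 mx u v Cu Cv; rewrite ger0_norm ?ipH_ge0 //.
(* Normalising fails for Q = 0, but then [u] vanishes on the union and P is 0. *)
have [Quv|Quv] := eqVneq (Q u v) 0.
  rewrite coupling_eq0 ?mulr_ge0 ?powR_ge0 ?coupling_ge0 // => x Ox.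
  have := ipH_ge_sqr u v Ox; rewrite Quv pmulr_rle0 // => h.
  apply/eqP; rewrite -sqrf_eq0 eq_le sqr_ge0 andbT.
  by apply: le_trans h; rewrite lerDl sqr_ge0.
have q0 : 0 < Q u v by rewrite lt_def Quv ipH_ge0.
set r := Num.sqrt (Q u v); have r0 : 0 < r by rewrite sqrtr_gt0.
have rr : Q u v = r ^+ 2 by rewrite sqr_sqrtr // ltW.
have rK (f : V -> R) : f = (fun x => r * (r^-1 * f x)).
  by apply/funext => x; rewrite mulVKf // gt_eqF.
rewrite rr (rK u) (rK v) coupling_scale // -powR_mulrn ?(ltW r0) // -powRrM.
rewrite (_ : 2%:R * ((a + b) / 2) = a + b); last by field.
rewrite mulrC ler_pM2r ?powR_gt0 //; apply: mx.
- by move=> x /Cu ->; rewrite mulr0.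
- by move=> x /Cv ->; rewrite mulr0.
- by rewrite ipH_scale rr exprVn mulVf // expf_neq0 // gt_eqF.
Qed.

(** * Rescaling, minimality and the Euler-Lagrange equation *)

Lemma ground_state_exists : exists u v,
  weak_solution w mu a b Oa Ob u v /\ Nehari w mu a b Oa Ob (u, v) /\
  J w mu a b Oa Ob u v = cN w mu a b Oa Ob.
Proof.
have [u0 [v0 [Cu0 Cv0 Q0 M0 mx]]] := coupling_max.
have le := coupling_le Q0 mx.
have [M EM] : exists M, P u0 v0 = M by exists (P u0 v0).
rewrite EM in M0 mx le.
have p2 : 2 < a + b by move: a1 b1; lra.
(* Q^q has the same degree of homogeneity a + b as P. *)
pose q := (a + b) / 2; have q1 : 1 < q by rewrite /q; lra.
have p0 : a + b != 0 by rewrite gt_eqF // (lt_trans _ p2).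
have p20 : a + b - 2 != 0 by rewrite gt_eqF // subr_gt0.
have [t t0 tM] : exists2 t, 0 < t & M * t `^ (a + b - 2) = 1.
  exists (M `^ (- (a + b - 2)^-1)); first by rewrite powR_gt0.
  by rewrite -powRrM mulNr mulVf // powR_inv1 ?mulfV ?gt_eqF // ltW.
(* The normalisation of [t] rewritten for Q = t^2, since 2(q - 1) = a + b - 2. *)
have tq : M * (t ^+ 2) `^ (q - 1) = 1.
  apply: (etrans _ tM); rewrite -powR_mulrn; last exact: ltW.
  rewrite -powRrM; congr (_ * _ `^ _).
  by rewrite /q; field.
pose u x := t * u0 x; pose v x := t * v0 x.
have Cu : Cc Oa u by move=> x /Cu0 h; rewrite /u h mulr0.
have Cv : Cc Ob v by move=> x /Cv0 h; rewrite /v h mulr0.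
have Quv : Q u v = t ^+ 2 by rewrite ipH_scale Q0 mulr1.
have Puv : P u v = t ^+ 2.
  rewrite coupling_scale // EM mulrC (_ : a + b = (a + b - 2) + 2%:R); last by ring.
  rewrite powRD; last by rewrite (gt_eqF t0) implybT.
  by rewrite mulrA tM mul1r powR_mulrn // ltW.
have Huv : H w mu Oa Ob u v by split; exact: Cc_W0.
have t20 : 0 < t ^+ 2 by rewrite exprn_gt0.
have Nuv : Nehari w mu a b Oa Ob (u, v).
  split => //=; split; last by rewrite dJ_self Quv Puv subrr.
  apply: contrapT => /not_orP[/contrapT u0' /contrapT v0'].
  move: t20; rewrite -Puv coupling_eq0 ?ltxx // => x _.
  by rewrite u0'.
have JN (u' v' : V -> R) : Nehari w mu a b Oa Ob (u', v') ->
    J w mu a b Oa Ob u' v' = (2^-1 - (a + b)^-1) * Q u' v'.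
  move=> [_ [_ /=]]; rewrite dJ_self => /eqP; rewrite subr_eq0 => /eqP E.
  by rewrite JE -E mulrBl.
(* Dividing Q = P <= M Q^q by Q > 0 leaves 1 <= M Q^(q-1); equality holds at t^2 and the power is
   increasing. *)
have lbQ (u' v' : V -> R) : Nehari w mu a b Oa Ob (u', v') -> t ^+ 2 <= Q u' v'.
  move=> [[[/= Cu' _] [Cv' _]] [/= nz]].
  rewrite dJ_self => /eqP; rewrite subr_eq0 => /eqP E.
  have Q0' := ipH_gt0 Cu' Cv' nz.
  have := le _ _ Cu' Cv'; rewrite -E gtr0_norm //.
  have -> : (a + b) / 2 = 1 + (q - 1) by rewrite /q; ring.
  rewrite powRD; last by rewrite (gt_eqF Q0') implybT.
  rewrite powRr1 ?(ltW Q0') // mulrCA ler_pMr // -[leLHS]tq ler_pM2l // => h.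
  rewrite leNgt; apply/negP => Qlt; move: h; rewrite leNgt.
  by rewrite gt0_ltr_powR ?subr_gt0 // nnegrE ltW.
exists u, v; split; last split => //.
  split=> // xi eta [[Cxi _] [Ceta _]].
  pose Qs s := Q (fun x => u x + s * xi x) (fun x => v x + s * eta x).
  pose Ps s := P (fun x => u x + s * xi x) (fun x => v x + s * eta x).
  (* [h >= 0] with equality at [s = 0], so [h'(0) = 0] is the Euler-Lagrange equation. *)
  pose h s := M * `|Qs s| `^ q - Ps s.
  have add0 (f g : V -> R) : (fun x => f x + 0 * g x) = f.
    by apply/funext => x; rewrite mul0r addr0.
  have Qs0 : Qs 0 = t ^+ 2 by rewrite /Qs !add0.
  have Ps0 : Ps 0 = t ^+ 2 by rewrite /Ps !add0.
  have dh s : is_derive s 1 h (M * (q * `|Qs s| `^ (q - 2) * Qs s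
      * (2 * ipH w mu Oa Ob u v xi eta + 2 * s * Q xi eta))
      - dP (fun x => u x + s * xi x) (fun x => v x + s * eta x) xi eta).
    exact: (is_deriveB (is_deriveZ M
      (@is_derive1_comp R (fun y => `|y| `^ q) Qs s _ _
         (is_derive_powR_norm (Qs s) q1) (is_derive_ipH u v xi eta s)))
      (is_derive_coupling u v xi eta s)).
  have h0 : h 0 = 0.
    rewrite /h Qs0 Ps0 gtr0_norm //.
    rewrite (_ : q = 1 + (q - 1)); last by ring.
    rewrite powRD; last by rewrite (gt_eqF t20) implybT.
    by rewrite powRr1 ?(ltW t20) // mulrCA tq mulr1 subrr.
  have hmin : is_derive (0 : R) 1 h 0.
    (* The inequality holds for all [s], so any open interval around 0 would do. *)
    apply: (@derive1_at_min R h (-1) 1 0).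
    - by lra.
    - by move=> s _; case: (dh s).
    - by rewrite in_itv /=; apply/andP; split; lra.
    (* The perturbed pair still vanishes off the domains, so the global bound applies to it. *)
    - move=> s _; rewrite h0 /h subr_ge0; apply: le => x.
        by move=> nx; rewrite Cu // Cxi // mulr0 addr0.
      by move=> nx; rewrite Cv // Ceta // mulr0 addr0.
  have := @derive_val _ _ _ _ _ _ _ hmin; rewrite (@derive_val _ _ _ _ _ _ _ (dh 0)).
  rewrite Qs0 !add0 gtr0_norm // mulr0 mul0r addr0.
  (* With this factor equal to 1, h'(0) = 0 says that 2q times the inner product of (u,v) and
     (xi,eta) equals [dP u v xi eta], where 2q = a + b. *)
  have tq' : M * ((t ^+ 2) `^ (q - 2) * t ^+ 2) = 1.
    apply: etrans tq; congr (_ * _); rewrite (_ : q - 1 = q - 2 + 1); last by ring.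
    rewrite [RHS]powRD; last by rewrite (gt_eqF t20) implybT.
    by rewrite powRr1 // ltW.
  have -> : M * (q * (t ^+ 2) `^ (q - 2) * t ^+ 2 * (2 * ipH w mu Oa Ob u v xi eta))
    = (M * ((t ^+ 2) `^ (q - 2) * t ^+ 2)) * (2 * q) * ipH w mu Oa Ob u v xi eta by ring.
  rewrite tq' mul1r => /eqP; rewrite subr_eq0 => /eqP E.
  have -> : ipH w mu Oa Ob u v xi eta = (a + b)^-1 * dP u v xi eta.
    by rewrite -E /q; field.
  rewrite /dcoupling -integZ //; congr integ; apply/funext => x.
  by field.
(* Positive because a + b > 2, so on the Nehari set minimising J means minimising Q. *)
have c0 : 0 < 2^-1 - (a + b)^-1.
  by rewrite subr_gt0 ltf_pV2 ?posrE // (lt_trans _ p2).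
have lbJ : lbound [set J w mu a b Oa Ob z.1 z.2 | z in Nehari w mu a b Oa Ob]
    (J w mu a b Oa Ob u v).
  move=> _ [[u' v'] /= N' <-].
  by rewrite (JN _ _ N') (JN _ _ Nuv) Quv ler_pM2l // lbQ.
apply/eqP; rewrite eq_le; apply/andP; split.
  by apply: lb_le_inf => //; exists (J w mu a b Oa Ob u v), (u, v).
by apply: ge_inf; [exists (J w mu a b Oa Ob u v)|exists (u, v)].
Qed.

End GraphFunctionals.

Theorem theorem1p2 (R : realType) (V : choiceType) (w : V -> V -> R) (mu : V -> R)
  (w_sym : forall x y, w x y = w y x)
  (w_ge0 : forall x y, 0 <= w x y)
  (hlf : locally_finite w)
  (hconn : graph_connected w)
  (mu_min : R) (hmu_min : 0 < mu_min) (hmu : forall x, mu_min <= mu x)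
  (a b : R) (ha : 1 < a) (hb : 1 < b)
  (Oa Ob : set V)
  (hOa : Oa !=set0) (hOb : Ob !=set0) (hOab : (Oa `&` Ob) !=set0)
  (bOa : bounded_domain w Oa) (bOb : bounded_domain w Ob)
  (bOab : bounded_domain w (Oa `&` Ob)) :
  exists u v : V -> R,
    weak_solution w mu a b Oa Ob u v /\
    Nehari w mu a b Oa Ob (u, v) /\
    J w mu a b Oa Ob u v = cN w mu a b Oa Ob.
Proof.
(* Positivity of [mu] comes from [mu_min], finiteness of the domains from bounded distance and local
   finiteness. *)
apply: ground_state_exists => //.
- by move=> x; exact: lt_le_trans hmu_min (hmu x).
- exact: bounded_domain_finite bOa.
- exact: bounded_domain_finite bOb.
Qed.
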